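(* Let $A_1,\ldots,A_m\in\mathbb{M}_d$. Then there exists a unitary matrix $V\in\mathbb{M}_d$ such that $$\left|\sum_{k=1}^m A_k\right|\le\sqrt{2}\,\left[\left\{\sum_{k=1}^m|A_k|_{\mathrm{qsym}}\right\}\#\left(V\left\{\sum_{k=1}^m|A_k|_{\mathrm{qsym}}\right\}V^*\right)\right].$$
   Context: $d,m\ge 1$ are integers, $\mathbb{M}_d$ is the space of complex $d\times d$ matrices and $\mathbb{M}_d^+$ its cone of positive semidefinite matrices; $\le$ between Hermitian matrices is the Loewner order. For $A\in\mathbb{M}_d$, $|A|=(A^*A)^{1/2}$, so $|A^*|=(AA^* )^{1/2}$. The quadratic symmetric modulus of $A$ is $$|A|_{\mathrm{qsym}}:=\sqrt{\frac{|A|^2+|A^*|^2}{2}}\in\mathbb{M}_d^+.$$ For $X,Y\in\mathbb{M}_d^+$, $X\#Y$ denotes the matrix geometric mean: for $X,Y$ positive definite $X\#Y=X^{1/2}(X^{-1/2}YX^{-1/2})^{1/2}X^{1/2}$, and in general $X\#Y=\lim_{\varepsilon\downarrow 0}(X+\varepsilon I)\#(Y+\varepsilon I)$. Equivalently, $X\#Y$ is the largest (in the Loewner order) Hermitian $H$ such that the block matrix $\begin{bmatrix}X&H\\H&Y\end{bmatrix}$ is positive semidefinite. *)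

(* Defs.v *)
From mathcomp Require Import all_boot all_order all_algebra.
From mathcomp Require Import all_classical all_reals all_analysis.
From mathcomp Require Import complex.
Import Order.TTheory GRing.Theory Num.Theory.
Import numFieldNormedType.Exports.

Set Implicit Arguments.
Unset Strict Implicit.
Unset Printing Implicit Defensive.

Local Open Scope classical_set_scope.
Local Open Scope ring_scope.
Local Open Scope sesquilinear_scope.

Section MatrixModuli.
Variables (C : numClosedFieldType) (d : nat).
Implicit Types A B X Y : 'M[C]_d.

(* [0 <= z] in C means that z is real and nonnegative. *)
Definition psdmx A : Prop :=
  A \is hermsymmx /\ forall x : 'rV[C]_d, 0 <= (x *m A *m x ^t*) 0 0.

Definition loewner_le A B : Prop :=
  [/\ A \is hermsymmx, B \is hermsymmx & psdmx (B - A)].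

(* Spectral calculus: for normal A, [spectralmx A] is unitary and
   A = (spectralmx A)^-1 *m diag_mx (spectral_diag A) *m spectralmx A
   (orthomx_spectralP); for A positive semidefinite the result is the positive
   semidefinite square root of A, otherwise it is meaningless. *)
Definition sqrtmx A : 'M[C]_d :=
  invmx (spectralmx A) *m diag_mx (map_mx sqrtC (spectral_diag A))
    *m spectralmx A.

Definition absmx A : 'M[C]_d := sqrtmx (A ^t* *m A).

Definition qsymmx A : 'M[C]_d :=
  sqrtmx (2^-1 *: (absmx A *m absmx A + absmx (A ^t*) *m absmx (A ^t*))).

(* The geometric mean, by its closed formula, of positive definite X and Y. *)
Definition pd_geomean X Y : 'M[C]_d :=
  let S := sqrtmx X in
  S *m sqrtmx (invmx S *m Y *m invmx S) *m S.

(* For positive semidefinite X and Y over R[i] with R : realType, the limit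
   exists, since the means of the perturbed matrices decrease with e; outside this case [lim] may be a default
   value.  As [0 < e] in C forces e to be real, [0^'+] is the filter of the real
   e that decrease to 0. *)
Definition geomean X Y : 'M[C]_d :=
  lim (pd_geomean (X + e%:M) (Y + e%:M) @[e --> (0 : C)^'+]).

End MatrixModuli.

(* Main.v *)
(* For A = U|A| with U unitary, the block matrix [[U|A|U*, A], [A*, |A|]] is
   positive semidefinite.  Both |A| and U|A|U* = |A*| are at most
   sqrt 2 |A|_qsym, because the square root is operator monotone.  Hence, with
   S the sum of the |A_k|_qsym and T the sum of the A_k,
   [[sqrt 2 S, T], [T*, sqrt 2 S]] is positive semidefinite.  With T = U|T|, a
   unitary congruence turns it into [[sqrt 2 S, |T|], [|T|, sqrt 2 U* S U]], and
   the theorem, with V = U*, follows from the maximality of the geometric mean.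
   The limit that defines the mean exists since the means of the perturbed
   matrices decrease with e. *)
Require Import Defs.
From mathcomp Require Import all_boot all_order all_algebra.
From mathcomp Require Import all_classical all_reals all_analysis.
From mathcomp Require Import complex ring.
Import Order.TTheory GRing.Theory Num.Theory.
Import numFieldNormedType.Exports.

Set Implicit Arguments.
Unset Strict Implicit.
Unset Printing Implicit Defensive.

Local Open Scope ring_scope.
Local Open Scope sesquilinear_scope.

(** * Adjoints, Gram matrices and the positive semidefinite cone *)

Section Psd.
Variables (C : numClosedFieldType).

Lemma adjmxM m n p (A : 'M[C]_(m, n)) (B : 'M[C]_(n, p)) :
  (A *m B)^t* = B^t* *m A^t*.
Proof. by rewrite trmx_mul map_mxM. Qed.

Lemma adjmxD m n (A B : 'M[C]_(m, n)) : (A + B)^t* = A^t* + B^t*.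
Proof. by rewrite linearD /= map_mxD. Qed.

Lemma adjmxB m n (A B : 'M[C]_(m, n)) : (A - B)^t* = A^t* - B^t*.
Proof. by rewrite linearB /= map_mxB. Qed.

Lemma adjmxN m n (A : 'M[C]_(m, n)) : (- A)^t* = - A^t*.
Proof. by rewrite linearN /= map_mxN. Qed.

Lemma adjmxZ m n c (A : 'M[C]_(m, n)) : (c *: A)^t* = c^* *: A^t*.
Proof. by rewrite linearZ /= map_mxZ. Qed.

Lemma hermsymmxP d (A : 'M[C]_d) : reflect (A^t* = A) (A \is hermsymmx).
Proof.
by apply: (iffP (is_hermitianmxP _ _ _)); rewrite expr0 scale1r.
Qed.

Lemma unitarymxPl n (U : 'M[C]_n) : U \is unitarymx -> U^t* *m U = 1%:M.
Proof. by move=> /unitarymxP/mulmx1C. Qed.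

Lemma sqnorm_ge0 n (u : 'rV[C]_n) : 0 <= (u *m u^t*) 0 0.
Proof.
by rewrite mxE sumr_ge0 // => j _; rewrite !mxE mul_conjC_ge0.
Qed.

Lemma sqnorm_eq0 n (u : 'rV[C]_n) : (u *m u^t*) 0 0 = 0 -> u = 0.
Proof.
rewrite mxE => /eqP; rewrite psumr_eq0; last first.
  by move=> j _; rewrite !mxE mul_conjC_ge0.
move=> /allP u0; apply/rowP=> j; have := u0 j (mem_index_enum _).
by rewrite !mxE /= mul_conjC_eq0 => /eqP.
Qed.

Lemma gram_eq0 m n (A : 'M[C]_(m, n)) : A *m A^t* = 0 -> A = 0.
Proof.
move=> /matrixP A0; apply/row_matrixP => i; rewrite row0; apply: sqnorm_eq0.
have := A0 i i; rewrite [RHS]mxE; apply: etrans; rewrite !mxE.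
by apply: eq_bigr => j _; rewrite !mxE.
Qed.

Lemma psdmx_congr m d (A : 'M[C]_(m, d)) (P : 'M[C]_d) :
  psdmx P -> psdmx (A *m P *m A^t*).
Proof.
move=> [/hermsymmxP hP P0]; split.
  by apply/hermsymmxP; rewrite !adjmxM trmxCK hP mulmxA.
by move=> x; have := P0 (x *m A); rewrite adjmxM !mulmxA.
Qed.

Lemma psdmxD d (A B : 'M[C]_d) : psdmx A -> psdmx B -> psdmx (A + B).
Proof.
move=> [/hermsymmxP hA A0] [/hermsymmxP hB B0]; split.
  by apply/hermsymmxP; rewrite adjmxD hA hB.
by move=> x; rewrite mulmxDr mulmxDl mxE addr_ge0.
Qed.

Lemma psdmx0 d : psdmx (0 : 'M[C]_d).
Proof.
split; first by apply/hermsymmxP; rewrite trmx0 map_mx0.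
by move=> x; rewrite mulmx0 mul0mx mxE.
Qed.

Lemma psdmx_sum d (I : finType) (F : I -> 'M[C]_d) :
  (forall i, psdmx (F i)) -> psdmx (\sum_i F i).
Proof. by move=> F0; elim/big_ind: _ => //; [exact: psdmx0|exact: psdmxD]. Qed.

Lemma psdmxZ d (c : C) (A : 'M[C]_d) : 0 <= c -> psdmx A -> psdmx (c *: A).
Proof.
move=> c0 [/hermsymmxP hA A0]; split.
  by apply/hermsymmxP; rewrite adjmxZ hA geC0_conj.
by move=> x; rewrite -scalemxAr -scalemxAl mxE mulr_ge0.
Qed.

Lemma psdmx_gram d n (A : 'M[C]_(d, n)) : psdmx (A *m A^t*).
Proof.
split; first by apply/hermsymmxP; rewrite adjmxM trmxCK.
by move=> x; have := sqnorm_ge0 (x *m A); rewrite adjmxM !mulmxA.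
Qed.

Lemma psdmx_diag d (D : 'rV[C]_d) : (forall i, 0 <= D 0 i) -> psdmx (diag_mx D).
Proof.
move=> D0; split.
  apply/hermsymmxP; rewrite tr_diag_mx map_diag_mx; congr diag_mx.
  by apply/rowP=> i; rewrite !mxE /= geC0_conj.
move=> x; rewrite mxE sumr_ge0 // => j _.
by rewrite mul_mx_diag !mxE mulrAC mulr_ge0 // mul_conjC_ge0.
Qed.

Lemma psdmx_scalar d (e : C) : 0 <= e -> psdmx (e%:M : 'M[C]_d).
Proof.
by move=> e0; rewrite -diag_const_mx; apply: psdmx_diag => i; rewrite mxE.
Qed.

(** * Spectral criterion for positivity; square roots and their monotonicity *)

Lemma spectral_decomp d (A : 'M[C]_d) : A \is hermsymmx ->
  A = (spectralmx A)^t* *m diag_mx (spectral_diag A) *m spectralmx A.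
Proof.
move=> /hermitian_normalmx /orthomx_spectralP {1}->.
by rewrite invmx_unitary // spectral_unitarymx.
Qed.

Lemma spectral_eigen d (A : 'M[C]_d) i : A \is hermsymmx ->
  let v := row i (spectralmx A) in
  v *m A = spectral_diag A 0 i *: v /\ (v *m v^t*) 0 0 = 1.
Proof.
move=> hA v; have PP := unitarymxP (spectral_unitarymx A); split.
  rewrite {1}(spectral_decomp hA) /v -row_mul !mulmxA PP mul1mx row_mul.
  by rewrite row_diag_mx -scalemxAl -rowE.
by have := row_unitarymxP (spectral_unitarymx A) i i; rewrite dotmxE eqxx.
Qed.

(** An eigenvalue is the value of the form at a unit eigenvector; conversely, [A] is a unitary
    congruence of its diagonal of eigenvalues. *)
Lemma spectral_diag_psd d (A : 'M[C]_d) : A \is hermsymmx ->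
  psdmx A <-> forall i, 0 <= spectral_diag A 0 i.
Proof.
move=> hA; split=> [[_ A0] i|D0]; last first.
  rewrite (spectral_decomp hA) -{2}[spectralmx A]trmxCK.
  exact/psdmx_congr/psdmx_diag.
have [vA vv] := spectral_eigen i hA.
by have := A0 (row i (spectralmx A)); rewrite vA -scalemxAl mxE vv mulr1.
Qed.

Lemma sqrtmx_psd d (A : 'M[C]_d) : psdmx A -> psdmx (sqrtmx A).
Proof.
move=> A0; have [hA _] := A0.
rewrite /sqrtmx invmx_unitary ?spectral_unitarymx //.
rewrite -{2}[spectralmx A]trmxCK; apply/psdmx_congr/psdmx_diag => i.
by rewrite mxE sqrtC_ge0; exact: (spectral_diag_psd hA).1.
Qed.

Lemma sqrtmxK d (A : 'M[C]_d) : psdmx A -> sqrtmx A *m sqrtmx A = A.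
Proof.
move=> [hA _]; rewrite [RHS](spectral_decomp hA) /sqrtmx.
rewrite invmx_unitary ?spectral_unitarymx //.
rewrite !mulmxA mulmxtVK ?spectral_unitarymx //.
rewrite -[_ *m diag_mx _ *m diag_mx _]mulmxA mulmx_diag.
congr (_ *m diag_mx _ *m _); apply/rowP=> i; rewrite !mxE -expr2; exact: sqrtCK.
Qed.

(* If Z - K had an eigenvalue t < 0 with unit eigenvector v, then
   vK = vZ - tv, so that |vK|^2 = |vZ|^2 - 2t vZv* + t^2 > |vZ|^2. *)
Lemma psdmx_sqr_le d (K Z : 'M[C]_d) : K \is hermsymmx -> psdmx Z ->
  psdmx (Z *m Z - K *m K) -> psdmx (Z - K).
Proof.
move=> /hermsymmxP hK [/hermsymmxP hZ Z0] [_ sqKZ].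
have hM : Z - K \is hermsymmx by apply/hermsymmxP; rewrite adjmxB hK hZ.
apply/(spectral_diag_psd hM) => i.
have [] := spectral_eigen i hM; set v := row i _; set t := spectral_diag _ 0 i.
move=> vM vv.
have treal : t \is Num.real.
  by have /mxOverP := hermitian_spectral_diag_real hM; apply.
rewrite real_leNgt ?real0 //; apply/negP => t0.
have vK : v *m K = v *m Z - t *: v.
  by rewrite -vM mulmxBr opprB addrC subrK.
have := sqKZ v; rewrite mulmxBr mulmxBl !mulmxA.
have sq (B : 'M[C]_d) : B^t* = B ->
    v *m B *m B *m v^t* = (v *m B) *m (v *m B)^t*.
  by move=> hB; rewrite adjmxM hB !mulmxA.
rewrite (sq K) // (sq Z) // vK adjmxB mulmxBl !mulmxBr adjmxZ adjmxM hZ.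
rewrite -!scalemxAl -!scalemxAr !mulmxA (CrealP treal).
move: (Z0 v) vv; move: (v *m Z *m v^t*) (v *m v^t*) (v *m Z *m Z *m v^t*).
move=> q w p q0 w1; rewrite !mxE w1.
have -> : p 0 0 - (p 0 0 - t * q 0 0 - (t * q 0 0 - t * (t * 1))) =
  - (t * t) - 2 * (- t) * q 0 0 by ring.
have tt : 0 < t * t by rewrite nmulr_rgt0.
have tq : 0 <= 2 * - t * q 0 0.
  by rewrite mulr_ge0 // mulr_ge0 // oppr_ge0 ltW.
move=> /le_lt_trans - /(_ 0); rewrite ltxx => H; apply/notF/H.
by rewrite -opprD oppr_lt0 ltr_pwDl.
Qed.

(** * Unitary completion and polar decomposition *)

Lemma unitarymx_complement r n (B : 'M[C]_(r, n)) : B \is unitarymx ->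
  exists2 Bc : 'M[C]_(n - r, n), Bc \is unitarymx &
    B^t* *m B + Bc^t* *m Bc = 1%:M.
Proof.
(* With row vectors, [K] spans the orthogonal complement of the row space of [B]; Gram-Schmidt on a
   basis of it gives [Bc]. *)
move=> hB; set K := kermx (B^t*).
have rB := mxrank_unitary hB.
have rK : \rank K = (n - r)%N by rewrite mxrank_ker mxrank_map mxrank_tr rB.
suff: exists2 Bc : 'M[C]_(\rank K, n),
    Bc \is unitarymx & B^t* *m B + Bc^t* *m Bc = 1%:M.
  by case: _ / rK.
exists (schmidt (row_base K)).
  by rewrite schmidt_unitarymx // rank_leq_col.
set Bc := schmidt _.
have hBc : Bc \is unitarymx by rewrite schmidt_unitarymx // rank_leq_col.
have BcB : Bc *m B^t* = 0.
  apply/sub_kermxP; rewrite -/K eqmx_schmidt_free ?row_base_free //.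
  by rewrite eq_row_base.
have BBc : B *m Bc^t* = 0.
  by rewrite -[B]trmxCK -adjmxM BcB trmx0 map_mx0.
have hcol : col_mx B Bc \is unitarymx.
  apply/unitarymxP; rewrite tr_col_mx map_row_mx mul_col_row BcB BBc.
  by rewrite (unitarymxP hB) (unitarymxP hBc) -scalar_mx_block.
(* The stacked matrix is square by [sz], so its orthonormal rows force orthonormal columns. *)
have sz : (r + \rank K)%N = n by rewrite rK subnKC // -rB rank_leq_col.
have := mulmxKtV 1%:M hcol sz.
by rewrite mul1mx tr_col_mx map_row_mx mul_row_col.
Qed.

(** The rows of [M] and of [N] have the same inner products, so sending each row of [N] to that of
    [M] is an isometry of row spaces; matching the orthogonal complements extends it to a
    unitary. *)
Lemma gram_eq_unitary m n (M N : 'M[C]_(m, n)) : M *m M^t* = N *m N^t* ->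
  exists2 U : 'M[C]_n, U \is unitarymx & M = N *m U.
Proof.
move=> MN.
have [r [B hB eqB]] :
    exists r, exists2 B : 'M[C]_(r, n), B \is unitarymx & (B :=: N)%MS.
  exists (\rank N), (schmidt (row_base N)).
    by rewrite schmidt_unitarymx // rank_leq_col.
  by apply: eqmx_trans (eq_row_base N); exact/eqmx_schmidt_free/row_base_free.
have NB : N = N *m B^t* *m B.
  have /submxP [X NX] : (N <= B)%MS by rewrite eqB.
  by rewrite [in RHS]NX mulmxtVK.
(* [B'] is the image of the orthonormal basis [B] under the isometry: [pinvmx N] expresses [B] by
   rows of [N], and the same combinations of rows of [M] are taken. *)
have [B' hB' MB'] :
    exists2 B' : 'M[C]_(r, n), B' \is unitarymx & M *m B'^t* = N *m B^t*.
  have LN : B *m pinvmx N *m N = B by rewrite mulmxKpV // eqB.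
  exists (B *m pinvmx N *m M).
    apply/unitarymxP; rewrite -(unitarymxP hB) -[in RHS]LN.
    by rewrite (adjmxM _ M) (adjmxM _ N) !mulmxA -(mulmxA _ M) MN mulmxA.
  by rewrite (adjmxM _ M) -[in RHS]LN (adjmxM _ N) !mulmxA MN.
have MB : M = N *m B^t* *m B'.
  set X := N *m B^t*.
  have B'M : B' *m M^t* = X^t* by rewrite /X -MB' adjmxM trmxCK.
  have MM : M *m M^t* = X *m X^t*.
    by rewrite MN /X adjmxM trmxCK mulmxA -NB.
  apply/eqP; rewrite -subr_eq0; apply/eqP/gram_eq0.
  rewrite adjmxB adjmxM mulmxBl !mulmxBr mulmxA MB' -/X.
  by rewrite -(mulmxA X) B'M mulmxA mulmxtVK // MM !subrr.
have [Bc hBc cB] := unitarymx_complement hB.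
have [Bc' hBc' cB'] := unitarymx_complement hB'.
(* Putting the resolution of the identity [cB] between [B] and [Bc^t*] shows that this product
   equals twice itself. *)
have BBc : B *m Bc^t* = 0.
  have := congr1 (fun X => B *m X *m Bc^t*) cB.
  rewrite mulmxDr !mulmxA (unitarymxP hB) mul1mx mulmx1 mulmxDl mulmxtVK //.
  by move=> /eqP; rewrite -subr_eq0 addrAC subrr add0r => /eqP.
(* This matrix carries the orthonormal basis [B], [Bc] to [B'], [Bc']. *)
exists (B^t* *m B' + Bc^t* *m Bc'); last first.
  rewrite mulmxDr !mulmxA -MB [in X in _ + X]NB -[_ *m B *m Bc^t*]mulmxA BBc.
  by rewrite mulmx0 mul0mx addr0.
rewrite -trmxC_unitary; apply/unitarymxP; rewrite trmxCK.
have BcB : Bc *m B^t* = 0 by rewrite -[Bc]trmxCK -adjmxM BBc trmx0 map_mx0.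
rewrite adjmxD !adjmxM !trmxCK mulmxDl !mulmxDr !mulmxA mulmxtVK // mulmxtVK //.
rewrite -[_ *m B *m Bc^t*]mulmxA BBc -[_ *m Bc *m B^t*]mulmxA BcB.
rewrite !mulmx0 !mul0mx.
by rewrite addr0 add0r.
Qed.

Lemma absmx_psd d (A : 'M[C]_d) : psdmx (absmx A).
Proof. by apply: sqrtmx_psd; have := psdmx_gram (A^t*); rewrite trmxCK. Qed.

Lemma absmxK d (A : 'M[C]_d) : absmx A *m absmx A = A^t* *m A.
Proof. by apply: sqrtmxK; have := psdmx_gram (A^t*); rewrite trmxCK. Qed.

(** [A^t*] and [absmx A] have the same Gram matrix [A^t* *m A], which handles singular [A] as
    well. *)
Lemma polar_decomposition d (A : 'M[C]_d) :
  exists2 U : 'M[C]_d, U \is unitarymx & A = U *m absmx A.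
Proof.
have [/hermsymmxP hP _] := absmx_psd A.
have [|U hU AU] := @gram_eq_unitary _ _ (A^t*) (absmx A).
  by rewrite trmxCK hP absmxK.
exists (U^t*); first by rewrite trmxC_unitary.
by rewrite -[LHS]trmxCK AU adjmxM hP.
Qed.
End Psd.

(** * The closed formula of the geometric mean and its maximality *)

Section GeoMean.
Variables (C : numClosedFieldType) (d : nat).
Implicit Types X Y H A B : 'M[C]_d.

(** A left kernel vector [v] satisfies [v X v^* = - e |v|^2], whose left side is nonnegative. *)
Lemma psdmx_addr_unit X (e : C) : psdmx X -> 0 < e -> X + e%:M \in unitmx.
Proof.
move=> [_ X0] e0; rewrite -row_free_unit -kermx_eq0; apply/eqP/row_matrixP => i.
rewrite row0; set v := row i _.
have vX : v *m (X + e%:M) = 0.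
  by apply/eqP; rewrite -sub_kermx row_sub.
have := X0 v; rewrite -[X](addrK e%:M) mulmxBr vX sub0r mulNmx mul_mx_scalar.
rewrite -scalemxAl !mxE -mulrN pmulr_rge0 // oppr_ge0 => v0.
by apply: sqnorm_eq0; apply/eqP; rewrite eq_le sqnorm_ge0 mxE v0.
Qed.

Lemma adjmxV X : (invmx X)^t* = invmx (X^t*).
Proof. by rewrite trmx_inv map_invmx. Qed.

Lemma psdmx_block_congr X H Y A B : psdmx (block_mx X H (H^t*) Y) ->
  psdmx (A *m X *m A^t* + B *m H^t* *m A^t* +
         (A *m H *m B^t* + B *m Y *m B^t*)).
Proof.
move=> /(psdmx_congr (row_mx A B)).
by rewrite mul_row_block tr_row_mx map_col_mx mul_row_col !mulmxDl.
Qed.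

(** [S] is the root of [X] and [Z] that of [S^-1 Y S^-1]. The properties of the mean are derived
    from these algebraic relations alone. *)
Lemma pd_geomeanP X Y : psdmx X -> X \in unitmx -> psdmx Y ->
  exists S Z, [/\ S^t* = S, S \in unitmx & X = S *m S] /\
    [/\ psdmx Z, Y = S *m (Z *m Z) *m S & pd_geomean X Y = S *m Z *m S].
Proof.
move=> X0 Xu Y0; have SS := sqrtmxK X0.
have Su : sqrtmx X \in unitmx.
  by move: (Xu); rewrite -{1}SS unitmx_mul => /andP[].
have [/hermsymmxP hS _] := sqrtmx_psd X0.
rewrite /pd_geomean; move: (sqrtmx X) SS Su hS => S SS Su hS.
have W0 : psdmx (invmx S *m Y *m invmx S).
  by rewrite -{2}hS -adjmxV; exact: psdmx_congr.
exists S, (sqrtmx (invmx S *m Y *m invmx S)); split=> //; split=> //.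
  exact: sqrtmx_psd.
by rewrite sqrtmxK // !mulmxA mulmxV // mul1mx mulmxKV.
Qed.

Lemma pd_geomean_psd X Y : psdmx X -> X \in unitmx -> psdmx Y ->
  psdmx (pd_geomean X Y).
Proof.
move=> X0 Xu Y0; have [S [Z [[hS _ _] [Z0 _ ->]]]] := pd_geomeanP X0 Xu Y0.
by rewrite -{2}hS; exact: psdmx_congr.
Qed.

(** This is the Gram matrix of the column with blocks [S] and [S *m Z]. *)
Lemma pd_geomean_block X Y : psdmx X -> X \in unitmx -> psdmx Y ->
  psdmx (block_mx X (pd_geomean X Y) (pd_geomean X Y) Y).
Proof.
move=> X0 Xu Y0.
have [S [Z [[hS _ ->] [[/hermsymmxP hZ _] -> ->]]]] := pd_geomeanP X0 Xu Y0.
have := psdmx_gram (col_mx S (S *m Z)).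
by rewrite tr_col_mx map_row_mx mul_col_row (adjmxM S) hS hZ !mulmxA.
Qed.

(** For [H = S K S], positivity of the Schur complement becomes [K^2 <= Z^2]; hence [K <= Z], and a
    congruence by [S] concludes. *)
Lemma pd_geomean_max X Y H : psdmx X -> X \in unitmx -> H^t* = H ->
  psdmx (block_mx X H H Y) -> psdmx (pd_geomean X Y - H).
Proof.
move=> X0 Xu hH; rewrite -{2}hH => XHY.
have Y0 : psdmx Y.
  have := psdmx_block_congr 0 1%:M XHY.
  by rewrite !mul0mx trmx0 map_mx0 mulmx0 !add0r trmx1 map_mx1 mul1mx mulmx1.
have [S [Z [[hS Su defX] [Z0 defY ->]]]] := pd_geomeanP X0 Xu Y0.
pose K := invmx S *m H *m invmx S.
have HK : H = S *m K *m S by rewrite /K !mulmxA mulmxV // mul1mx mulmxKV.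
have hSV : (invmx S)^t* = invmx S by rewrite adjmxV hS.
have hK : K^t* = K by rewrite /K !adjmxM hH hSV mulmxA.
clearbody K.
rewrite HK -mulmxBl -mulmxBr -{2}hS.
apply/psdmx_congr/psdmx_sqr_le => //; first exact/hermsymmxP.
(* The row is [S^-1] times the row with blocks [- H X^-1] and 1, so the congruence gives the Schur
   complement [Z^2 - K^2]. *)
have := psdmx_block_congr (- (K *m invmx S)) (invmx S) XHY.
rewrite hH HK defX defY adjmxN adjmxM hSV hK !mulmxA.
rewrite !mulNmx !mulmxN opprK.
have E1 p (M : 'M[C]_(p, d)) : M *m invmx S *m S = M by rewrite mulmxKV.
have E2 p (M : 'M[C]_(p, d)) : M *m S *m invmx S = M by rewrite mulmxK.
rewrite mulVmx // mul1mx !(E1, E2).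
by rewrite subrr add0r mul1mx addrC.
Qed.

(** Adding [e' - e] to the diagonal of the block matrix for [e] makes the mean at [e] a competitor
    in the maximality at [e']. *)
Lemma pd_geomean_shift_mono X Y (e e' : C) : psdmx X -> psdmx Y ->
  0 < e -> e <= e' ->
  psdmx (pd_geomean (X + e'%:M) (Y + e'%:M) - pd_geomean (X + e%:M) (Y + e%:M)).
Proof.
move=> X0 Y0 e0 ee'; have e'0 := lt_le_trans e0 ee'.
have Xe := psdmxD X0 (psdmx_scalar _ (ltW e0)).
have Ye := psdmxD Y0 (psdmx_scalar _ (ltW e0)).
apply: pd_geomean_max.
- exact/psdmxD/psdmx_scalar/ltW.
- exact: psdmx_addr_unit.
- by apply/hermsymmxP; case: (pd_geomean_psd Xe (psdmx_addr_unit X0 e0) Ye).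
have ee'0 : 0 <= e' - e by rewrite subr_ge0.
have := psdmxD (pd_geomean_block Xe (psdmx_addr_unit X0 e0) Ye)
  (psdmx_scalar (d + d) ee'0).
rewrite scalar_mx_block add_block_mx !addr0 -!addrA.
by rewrite -!(raddfD scalar_mx) /= subrKC.
Qed.
End GeoMean.

(** * Limits of matrices and of their quadratic forms *)

Section MatrixLimits.
Local Open Scope classical_set_scope.
Variables (C : numClosedFieldType) (d : nat) (T : Type) (F : set_system T).
Context {FF : ProperFilter F}.

Lemma cvg_mxP m n (f : T -> 'M[C]_(m, n)) (L : 'M[C]_(m, n)) :
  (forall i j, f x i j @[x --> F] --> L i j) -> f x @[x --> F] --> L.
Proof.
move=> fL; apply/cvg_ballP => e e0.
have H : \forall x \near F, forall ij : 'I_m * 'I_n,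
    ball (L ij.1 ij.2) e (f x ij.1 ij.2).
  apply: filter_forall => -[i j].
  by have /cvg_ballP/(_ e e0) := fL i j.
by apply: filterS H => x H; split=> // i j; exact: H (i, j).
Qed.

Lemma cvg_coord m n (f : T -> 'M[C]_(m, n)) (L : 'M[C]_(m, n)) i j :
  f x @[x --> F] --> L -> f x i j @[x --> F] --> L i j.
Proof.
move=> fL; apply: (@cvg_comp _ _ _ f (fun M => M i j) _ _ _ fL).
exact: coord_continuous.
Qed.

Lemma cvg_form (f : T -> 'M[C]_d) (L : 'M[C]_d) (u : 'rV[C]_d) (v : 'cV[C]_d) :
  f x @[x --> F] --> L ->
  (u *m f x *m v) 0 0 @[x --> F] --> (u *m L *m v) 0 0.
Proof.
move=> fL; rewrite mxE.
under eq_fun do rewrite mxE.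
apply: cvg_big => [|j _]; [exact: add_continuous|].
apply: cvgM; last exact: cvg_cst.
rewrite mxE; under eq_fun do rewrite mxE.
apply: cvg_big => [|k _]; [exact: add_continuous|].
apply: cvgM; first exact: cvg_cst.
exact: cvg_coord.
Qed.

Lemma cvg_conjC (f : T -> C) (l : C) :
  f x @[x --> F] --> l -> (f x)^* @[x --> F] --> l^*.
Proof.
move=> /cvgrPdist_lt fl; apply/cvgrPdist_lt => e e0.
by apply: filterS (fl e e0) => x; rewrite -rmorphB norm_conjC.
Qed.

(** The order on [C] is partial, so nonnegativity is tested as [l = |l|], which passes to the limit
    by continuity of the norm. *)
Lemma cvg_ge0 (f : T -> C) (l : C) :
  (\forall x \near F, 0 <= f x) -> f x @[x --> F] --> l -> 0 <= l.
Proof.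
move=> f0 fl.
suff -> : l = `|l| by [].
apply: (cvg_unique _ fl); first exact: norm_hausdorff.
apply: cvg_trans (cvg_norm fl); apply: near_eq_cvg.
by apply: filterS f0 => x /ger0_norm ->.
Qed.

Lemma cvg_psdmx (f : T -> 'M[C]_d) (L : 'M[C]_d) :
  (\forall x \near F, psdmx (f x)) -> f x @[x --> F] --> L -> psdmx L.
Proof.
move=> f0 fL; split.
  apply/hermsymmxP/matrixP => i j; rewrite !mxE.
  apply: (cvg_unique _ (cvg_conjC (cvg_coord fL))); first exact: norm_hausdorff.
  apply: cvg_trans (cvg_coord fL); apply: near_eq_cvg.
  apply: filterS f0 => x -[/hermsymmxP hx _]; by rewrite -{1}hx !mxE.
move=> u; apply: (cvg_ge0 _ (cvg_form fL)).
by apply: filterS f0 => x -[].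
Qed.

(* Polarization: 2 u M v^* = q (u + v) + i q (u + i v) - (1 + i) (q u + q v),
   where q w = w M w^*. *)
Lemma is_cvg_mx_form (f : T -> 'M[C]_d) :
  (forall u : 'rV[C]_d, cvg ((u *m f x *m u^t*) 0 0 @[x --> F])) ->
  cvg (f x @[x --> F]).
Proof.
move=> qf; pose q (u : 'rV[C]_d) x := (u *m f x *m u^t*) 0 0.
pose e i : 'rV[C]_d := delta_mx 0 i.
have pol i j x : f x i j = 2^-1 * (q (e i + e j) x + 'i * q (e i + 'i *: e j) x
    - (1 + 'i) * (q (e i) x + q (e j) x)).
  have s k l : (e k *m f x *m (e l)^t*) 0 0 = f x k l.
    by rewrite trmx_delta map_delta_mx -colE -rowE !mxE.
  rewrite -s /q !adjmxD adjmxZ conjCi !mulmxDl !mulmxDr -!scalemxAl -!scalemxAr.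
  move: (e i *m f x *m (e i)^t*) (e i *m f x *m (e j)^t*).
  move: (e j *m f x *m (e i)^t*) (e j *m f x *m (e j)^t*) => c b a z.
  rewrite !mxE; have /eqP := sqrCi C; rewrite -addr_eq0 expr2.
  move: 'i => I /eqP I2.
  apply: (@mulfI _ 2); first by rewrite pnatr_eq0.
  rewrite mulrA divff ?pnatr_eq0 // mul1r.
  (* For [ring], [I] is an indeterminate, so the multiple of [I * I + 1] separating the two sides is
     inserted by hand. *)
  transitivity (2 * z 0 0 - (I * I + 1) * (z 0 0 - c 0 0 + I * b 0 0)).
    by rewrite I2 mul0r subr0.
  by ring.
apply/cvg_ex; exists (\matrix_(i, j) (2^-1 * (lim (q (e i + e j) @ F) +
  'i * lim (q (e i + 'i *: e j) @ F) -
  (1 + 'i) * (lim (q (e i) @ F) + lim (q (e j) @ F))))).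
apply: cvg_mxP => i j; rewrite mxE; under eq_fun do rewrite pol.
by apply: cvgMl_tmp; apply: cvgB;
  [apply: cvgD; [|apply: cvgMl_tmp]|apply: cvgMl_tmp; apply: cvgD]; apply: qf.
Qed.
End MatrixLimits.

(** * The block matrix of the quadratic symmetric modulus *)

Section QsymBlock.
Variables (C : numClosedFieldType) (d : nat).
Implicit Types A T S : 'M[C]_d.

Lemma psdmx_block_diag A B : psdmx A -> psdmx B ->
  psdmx (block_mx A 0 0 B : 'M[C]_(d + d)).
Proof.
move=> A0 B0.
have := psdmxD (psdmx_congr (col_mx 1%:M 0) A0)
  (psdmx_congr (col_mx 0 1%:M) B0).
rewrite !tr_col_mx !map_row_mx (mul_col_mx _ _ A) (mul_col_mx _ _ B).
rewrite !mul_col_row add_block_mx.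
by rewrite !trmx1 !trmx0 !map_mx1 !map_mx0
  !(mulmx1, mul1mx, mulmx0, mul0mx, addr0, add0r).
Qed.

Lemma psdmx_half_sqr_sum A :
  psdmx (2^-1 *: (absmx A *m absmx A + absmx (A^t*) *m absmx (A^t*))).
Proof.
apply: psdmxZ; first by rewrite invr_ge0 ler0n.
rewrite !absmxK trmxCK; apply: psdmxD; last exact: psdmx_gram.
by have := psdmx_gram (A^t*); rewrite trmxCK.
Qed.

Lemma qsymmx_psd A : psdmx (qsymmx A).
Proof. exact/sqrtmx_psd/psdmx_half_sqr_sum. Qed.

(** The constant sqrt 2 cancels the half under the root, so that this square dominates both [|A|^2]
    and [|A^*|^2]. *)
Lemma sqrt2_qsymmxK A : (sqrtC 2 *: qsymmx A) *m (sqrtC 2 *: qsymmx A) =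
  A^t* *m A + A *m A^t*.
Proof.
rewrite -scalemxAl -scalemxAr scalerA -expr2 sqrtCK sqrtmxK.
  by rewrite scalerA divff ?pnatr_eq0 // scale1r !absmxK trmxCK.
exact: psdmx_half_sqr_sum.
Qed.

Lemma qsymmx_block A :
  psdmx (block_mx (sqrtC 2 *: qsymmx A) A (A^t*) (sqrtC 2 *: qsymmx A)).
Proof.
have [U hU AU] := polar_decomposition A.
have UA : U^t* *m A = absmx A by rewrite {1}AU mulmxA unitarymxPl // mul1mx.
have P0 := absmx_psd A; have PP := absmxK A.
have [/hermsymmxP hP _] := P0.
have adjA : A^t* = absmx A *m U^t* by rewrite {1}AU adjmxM hP.
have K0 := psdmx_congr U P0.
have Q0 : psdmx (sqrtC 2 *: qsymmx A).
  by apply: psdmxZ (qsymmx_psd A); rewrite sqrtC_ge0 ler0n.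
have QP : psdmx (sqrtC 2 *: qsymmx A - absmx A).
  apply: psdmx_sqr_le => //; first by case: P0.
  by rewrite sqrt2_qsymmxK PP addrC addKr; exact: psdmx_gram.
(* The subtracted matrix is [|A^*|]: its square is [A A^*], which leaves the Gram matrix [A^* A]. *)
have QK : psdmx (sqrtC 2 *: qsymmx A - U *m absmx A *m U^t*).
  apply: psdmx_sqr_le => //; first by case: K0.
  have -> : U *m absmx A *m U^t* *m (U *m absmx A *m U^t*) = A *m A^t*.
    by rewrite -AU adjA -UA !mulmxA.
  by rewrite sqrt2_qsymmxK addrK; have := psdmx_gram (A^t*); rewrite trmxCK.
(* The congruence supplies the off-diagonal blocks; the block diagonal summand raises the diagonal
   to sqrt 2 times the modulus. *)
have := psdmxD (psdmx_congr (col_mx U 1%:M) P0) (psdmx_block_diag QK QP).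
rewrite tr_col_mx map_row_mx (mul_col_mx _ _ (absmx A)) mul_col_row.
rewrite trmx1 map_mx1 mul1mx !mulmx1.
rewrite add_block_mx !addr0 !subrKC -AU.
by rewrite -adjA.
Qed.

Lemma psdmx_block_sum_qsym m (A : 'I_m -> 'M[C]_d) :
  psdmx (block_mx (sqrtC 2 *: \sum_k qsymmx (A k)) (\sum_k A k)
    ((\sum_k A k)^t*) (sqrtC 2 *: \sum_k qsymmx (A k))).
Proof.
elim/big_rec2: _ => [|k s t _ IH].
  by rewrite scaler0 trmx0 map_mx0; apply: psdmx_block_diag; exact: psdmx0.
have := psdmxD (qsymmx_block (A k)) IH.
by rewrite add_block_mx -!scalerDr adjmxD.
Qed.
End QsymBlock.

(** * Maximality of the limit mean, and the inequality given convergence *)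

Section GeomeanLimit.
Local Open Scope classical_set_scope.
Variables (C : numClosedFieldType) (d : nat).

(** Shifting [X] and [Y] by [e] shifts the whole block matrix by [e], so [H] lies below every
    perturbed mean, and the cone is closed. *)
Lemma geomean_max (X Y H : 'M[C]_d) : psdmx X ->
  cvg (pd_geomean (X + e%:M) (Y + e%:M) @[e --> (0 : C)^'+]) -> H^t* = H ->
  psdmx (block_mx X H H Y) -> psdmx (geomean X Y - H).
Proof.
move=> X0 cvgG hH XHY.
pose G e := pd_geomean (X + e%:M) (Y + e%:M).
apply: (@cvg_psdmx C d _ ((0 : C)^'+) _ (fun e => G e - H)); last first.
  by apply: cvgB; [exact: cvgG|exact: cvg_cst].
near=> e; have e0 : 0 < e by near: e; exact: nbhs_right_gt.
have E0 n := @psdmx_scalar C n e (ltW e0).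
apply: pd_geomean_max => //; [exact: psdmxD|exact: psdmx_addr_unit|].
have := psdmxD XHY (E0 (d + d)%N).
by rewrite scalar_mx_block add_block_mx !addr0.
Unshelve. all: by end_near. Qed.

(** Convergence is a hypothesis because the field is general here; over [R[i]] it comes from infima
    of real numbers. *)
Lemma absmx_sum_le_geomean m (A : 'I_m -> 'M[C]_d)
    (S := \sum_k qsymmx (A k)) :
  (forall X Y : 'M[C]_d, psdmx X -> psdmx Y ->
    cvg (pd_geomean (X + e%:M) (Y + e%:M) @[e --> (0 : C)^'+])) ->
  exists2 V : 'M[C]_d, V \is unitarymx &
    loewner_le (absmx (\sum_k A k)) (sqrtC 2 *: geomean S (V *m S *m V^t*)).
Proof.
move=> cvgG; have := psdmx_block_sum_qsym A.
have : psdmx S by apply: psdmx_sum => k; exact: qsymmx_psd.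
rewrite -/S; move: (\sum_k A k) S => T {A}S S0 STS.
have [U hU TU] := polar_decomposition T.
have T0 := absmx_psd T; have [hT _] := T0; have hT' := hermsymmxP _ hT.
exists (U^t*); first by rewrite trmxC_unitary.
have s0 : 0 <= sqrtC 2 :> C by rewrite sqrtC_ge0 ler0n.
have s_neq0 : sqrtC 2 != 0 :> C by rewrite sqrtC_eq0 pnatr_eq0.
rewrite trmxCK.
suff GT : psdmx (sqrtC 2 *: geomean S (U^t* *m S *m U) - absmx T).
  split=> //; apply/hermsymmxP.
  have [/hermsymmxP] := psdmxD GT T0.
  by rewrite subrK.
(* The factor sqrt 2 is moved to the other side: the competitor for the mean is [|T|] divided by
   sqrt 2. *)
rewrite -[absmx T](scalerKV s_neq0) -scalerBr; apply: psdmxZ => //.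
apply: geomean_max => //.
- by apply: cvgG => //; rewrite -{2}[U]trmxCK; exact: psdmx_congr.
- by rewrite adjmxZ hT' geC0_conj // invr_ge0.
have sV0 : 0 <= (sqrtC 2)^-1 :> C by rewrite invr_ge0.
(* The congruence swaps the blocks and rotates one of them by [U^t*]: before scaling, the diagonal
   is sqrt 2 times [S] and [U^* S U], and both off-diagonal blocks are [|T|]. *)
have := psdmxZ sV0 (psdmx_congr (block_mx 0 1%:M (U^t*) 0) STS).
rewrite tr_block_mx map_block_mx !trmx0 !trmx1 !map_mx0 !map_mx1 trmxCK.
rewrite !mulmx_block !(mulmx1, mul1mx, mulmx0, mul0mx, addr0, add0r).
rewrite scale_block_mx -!scalemxAr -!scalemxAl !scalerA mulVf // !scale1r.
have UT : U^t* *m T = absmx T by rewrite {1}TU mulmxA unitarymxPl // mul1mx.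
have TU' : T^t* *m U = absmx T by rewrite -[U]trmxCK -adjmxM UT hT'.
by rewrite UT TU'.
Qed.
End GeomeanLimit.

Local Open Scope complex_scope.

(** * Convergence of the perturbed means over [R[i]] *)

Section ComplexLimit.
Local Open Scope classical_set_scope.
Variable R : realType.
Local Notation C := (R[i] : numClosedFieldType).

(** On positive arguments [f] is real-valued, and its limit is the infimum of its values, taken in
    [R]. *)
Lemma nondecreasing_at0_is_cvg (f : C -> C) :
  (forall e, 0 < e -> 0 <= f e) ->
  (forall e e', 0 < e -> e <= e' -> f e <= f e') ->
  cvg (f e @[e --> 0^'+]).
Proof.
move=> f0 fmono.
pose S := [set complex.Re (f e) | e in [set e : C | 0 < e]].
have fR e : 0 < e -> f e = (complex.Re (f e))%:C.
  move=> /f0; rewrite lecE /= => /andP[+ _]; by case: (f e) => a b /= /eqP ->.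
have hS : has_inf S.
  split; first by exists (complex.Re (f 1)), 1; rewrite /= ?ltr01.
  exists 0 => _ [e /= e0 <-]; have := f0 e e0; rewrite fR //.
  by rewrite (lecR 0).
apply/cvg_ex; exists ((inf S)%:C); apply/cvgrPdist_lt => eps eps0.
have epsR : eps = (complex.Re eps)%:C.
  by move: eps0; rewrite ltcE /= => /andP[/eqP]; case: (eps) => a b /= ->.
have eps0' : 0 < complex.Re eps by move: eps0; rewrite epsR (ltcR 0).
have [_ [e0 /= e00 <-] He0] := inf_adherent eps0' hS.
near=> e.
have e_gt0 : 0 < e by near: e; exact: nbhs_right_gt.
have ee0 : e <= e0 by near: e; exact: nbhs_right_le.
rewrite distrC ger0_norm ?subr_ge0 fR // ?lecR; last first.
  by apply: ge_inf; [case: hS|exists e].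
rewrite -rmorphB /= epsR ltcR ltrBlDl; apply: le_lt_trans He0.
by have := fmono e e0 e_gt0 ee0; rewrite fR // (fR e0) // lecR.
Unshelve. all: by end_near. Qed.

(** Each quadratic form of the perturbed mean is nonnegative and nondecreasing in [e], hence
    converges; polarization passes this on to the matrix. *)
Lemma is_cvg_geomean d (X Y : 'M[C]_d) : psdmx X -> psdmx Y ->
  cvg (pd_geomean (X + e%:M) (Y + e%:M) @[e --> (0 : C)^'+]).
Proof.
move=> X0 Y0; apply: is_cvg_mx_form => u.
pose f (e : C) := (u *m pd_geomean (X + e%:M) (Y + e%:M) *m u^t*) 0 0.
apply: (@nondecreasing_at0_is_cvg f) => [e e0|e e' e0 ee'].
  have [_] := pd_geomean_psd (psdmxD X0 (psdmx_scalar _ (ltW e0)))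
    (psdmx_addr_unit X0 e0) (psdmxD Y0 (psdmx_scalar _ (ltW e0))).
  exact.
have [_ /(_ u)] := pd_geomean_shift_mono X0 Y0 e0 ee'.
by rewrite mulmxBr mulmxBl mxE [X in _ + X]mxE subr_ge0.
Qed.
End ComplexLimit.

Theorem theorem2p2 (R : realType) (d m : nat) (hd : (0 < d)%N) (hm : (0 < m)%N)
    (A : 'I_m -> 'M[R[i]]_d) :
  exists2 V : 'M[R[i]]_d, V \is unitarymx &
    loewner_le (absmx (\sum_(k < m) A k))
      (sqrtC 2 *: geomean (\sum_(k < m) qsymmx (A k))
                    (V *m (\sum_(k < m) qsymmx (A k)) *m V ^t*)).
Proof. apply: absmx_sum_le_geomean => X Y; exact: is_cvg_geomean. Qed.
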